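(* Let $G_0\subset G$ be finite and $V\subset M$ a non-empty open set. Let $G_0'=\{s^{-1}t:s,t\in G_0\}=D_0\cup\tilde D$ with $D_0=G_0'\setminus\tilde D$, and let $\emptyset\ne\Delta\subset V$ be an open set such that $\beta_g|_\Delta=\mathrm{id}_\Delta$ for $g\in\tilde D$ and $\beta_g(\Delta)\cap\Delta=\emptyset$ for $g\in D_0$. Then for $b=\sum_{g\in G_0}a_gU_g$, $a_g\in\mathcal A$, and any $z_\Delta\in\mathcal Z(\Delta)$, $$\|z_\Delta b^*b\|\ \ge\ \Big\|z_\Delta\Big(\tilde a+\sum_{s\ne t\in G_0,\ s^{-1}t\in\tilde D}\alpha_s^{-1}(a_s^*a_t)\,U_{s^{-1}t}\Big)\Big\| ,\qquad \tilde a=\sum_{s\in G_0}\alpha_s^{-1}(a_s^*a_s).$$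
   Context: Setting. $H$ is a Hilbert space, $\mathcal A\subset B(H)$ is a unital $C^*$-subalgebra with $1_{\mathcal A}=I$, $G$ is a discrete group with identity $e$, $U:G\to B(H)$, $g\mapsto U_g$, is a unitary representation, and $\mathcal Z$ is a central $C^*$-subalgebra of $\mathcal A$ with $1_{\mathcal A}\in\mathcal Z$. It is assumed that for every $g\in G$, $\alpha_g(a)=U_gaU_g^*$ defines a $*$-automorphism of both $\mathcal A$ and $\mathcal Z$. $M$ is the compact Hausdorff maximal ideal (character) space of $\mathcal Z$, and $\mathcal Z$ is identified with $C(M)$ by the Gelfand transform. For $g\in G$, $\beta_g:M\to M$ is the homeomorphism with $z(\beta_g(m))=(\alpha_g(z))(m)$ for $z\in\mathcal Z$, $m\in M$. For a non-empty open $\Delta\subset M$, $\mathcal Z(\Delta)=\{z\in C(M):0\le z\le1,\ \|z\|=1,\ \mathrm{supp}\,z\subset\Delta\}$. Norms are operator norms in $B(H)$. *)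

(* Defs.v *)
From HB Require Import structures.
From mathcomp Require Import all_boot all_order all_algebra.
From mathcomp Require Import sesquilinear finmap complex.
From mathcomp Require Import all_classical all_reals all_analysis.

Set Implicit Arguments.
Unset Strict Implicit.
Unset Printing Implicit Defensive.

Import Order.TTheory GRing.Theory Num.Theory.
Import numFieldNormedType.Exports.

Local Open Scope classical_set_scope.
Local Open Scope ring_scope.
Local Open Scope complex_scope.

(* The library attaches the norm topology to an abstract numClosedFieldType;
   this makes it available on the concrete field R[i]. *)
HB.instance Definition _ (R : realType) :=
  NormedModule.copy R[i] ((R[i] : numClosedFieldType) : normedModType _).

(* The inner product is linear in its first argument and conjugate-linear in
   the second. *)
HB.mixin Record CompleteNormedModule_isHilbert (R : realType) H
    & CompleteNormedModule R[i] H := {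
  ip : {dot H for (Num.conj : R[i] -> R[i])} ;
  ip_norm : forall x : H, ip x x = `|x| ^+ 2
}.

#[short(type="hilbertType")]
HB.structure Definition Hilbert (R : realType) :=
  {H of CompleteNormedModule R[i] H & CompleteNormedModule_isHilbert R H}.

Section BoundedOperators.
Variables (R : realType) (H : hilbertType R).

Definition bounded_op : {pred H -> H} :=
  mem [set f : H -> H | linear f /\
        exists M : R, forall x, `|f x| <= M%:C * `|x|].

Lemma bounded_op_submod : submod_closed bounded_op.
Proof.
split.
  rewrite inE; split=> [c x y|]; first by rewrite /= scaler0 addr0.
  by exists 0 => x; rewrite normr0 mul0r.
move=> c f g; rewrite !inE => -[lf [M fM]] [lg [N gN]]; split.
  move=> d x y; rewrite /= !fctE lf lg !scalerDr !scalerA (mulrC c d).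
  by rewrite !addrA; congr (_ + _); rewrite addrAC.
exists (complex.Re `|c| * M + N) => x; rewrite fctE.
rewrite (le_trans (ler_normD _ _))// normrZ rmorphD rmorphM /= mulrDl lerD//.
by rewrite -mulrA; exact: ler_wpM2l (normr_ge0 c) _ _ (fM x).
Qed.

HB.instance Definition _ :=
  GRing.isSubmodClosed.Build R[i] (H -> H) bounded_op bounded_op_submod.

Record bop : Type := Bop { bop_fun :> H -> H ; _ : bop_fun \in bounded_op }.

HB.instance Definition _ := [isSub for bop_fun].
HB.instance Definition _ := gen_eqMixin bop.
HB.instance Definition _ := gen_choiceMixin bop.
HB.instance Definition _ := [SubChoice_isSubLmodule of bop by <:].

Implicit Types S T : bop.

Lemma bop_linear T : linear T.
Proof. by case: T => f /=; rewrite inE => -[]. Qed.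

HB.instance Definition _ T :=
  GRing.isLinear.Build R[i] H H *:%R T (bop_linear T).

Lemma bop_bounded T : exists M : R, forall x, `|T x| <= M%:C * `|x|.
Proof. by case: T => f /=; rewrite inE => -[]. Qed.

Lemma bop_ext S T : (forall x, S x = T x) -> S = T.
Proof. by move=> ST; apply: val_inj; apply/funext. Qed.

Lemma bop_one_subproof : idfun \in bounded_op.
Proof. by rewrite inE; split=> //; exists 1 => x; rewrite mul1r. Qed.

Lemma bop_mul_subproof S T : (S \o T : H -> H) \in bounded_op.
Proof.
rewrite inE; split=> [c x y|]; first by rewrite /= !linearP.
have [M SM] := bop_bounded S; have [N TN] := bop_bounded T.
exists (Normc.normc (M%:C) * N) => x.
rewrite (le_trans (SM _))//= rmorphM /= -mulrA.
rewrite (le_trans (ler_wpM2r (normr_ge0 _) _ : _ <= `|M%:C| * _))//.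
  by rewrite real_ler_norm// complex_real.
exact: ler_wpM2l (normr_ge0 (M%:C : R[i])) _ _ (TN x).
Qed.

Definition bop_one : bop := Bop bop_one_subproof.
Definition bop_mul S T : bop := Bop (bop_mul_subproof S T).

Lemma bop_mulA : associative bop_mul. Proof. by move=> *; exact: bop_ext. Qed.
Lemma bop_mul1 : left_id bop_one bop_mul. Proof. by move=> *; exact: bop_ext. Qed.
Lemma bop_mulr1 : right_id bop_one bop_mul. Proof. by move=> *; exact: bop_ext. Qed.
Lemma bop_mulDl : left_distributive bop_mul +%R.
Proof. by move=> *; exact: bop_ext. Qed.
Lemma bop_mulDr : right_distributive bop_mul +%R.
Proof. by move=> S T1 T2; apply: bop_ext => x; exact: (linearD S). Qed.

(* bop is a pzRingType with a separate left-module structure: the library's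
   algebra structures require 1 != 0, which fails when H = 0. *)
HB.instance Definition _ := GRing.Zmodule_isPzRing.Build bop
  bop_mulA bop_mul1 bop_mulr1 bop_mulDl bop_mulDr.

(* `|x| : R[i] is a nonnegative real, whence the real part. *)
Definition opnorm T : R :=
  sup [set complex.Re `|T x| | x in [set x : H | `|x| <= 1]].

Lemma opnorm_has_sup T :
  has_sup [set complex.Re `|T x| | x in [set x : H | `|x| <= 1]].
Proof.
split; first by exists (complex.Re `|T 0|); exists 0 => //=; rewrite normr0.
have [M TM] := bop_bounded T; exists (Normc.normc M%:C) => _ [x /= x1 <-].
rewrite -lecR RRe_real ?normr_real// (le_trans (TM x))//.
rewrite (le_trans (ler_wpM2r (normr_ge0 _) _ : _ <= `|M%:C| * _))//.
  by rewrite real_ler_norm// complex_real.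
by rewrite -[leRHS]mulr1; exact: ler_wpM2l (normr_ge0 (M%:C : R[i])) _ _ x1.
Qed.

Lemma opnorm_ub T x : `|T x| <= (opnorm T)%:C * `|x|.
Proof.
have [->|x0] := eqVneq x 0; first by rewrite linear0 !normr0 mulr0.
rewrite -ler_pdivrMr ?normr_gt0// mulrC.
have nx : `| `|x|^-1 | = `|x|^-1 by rewrite ger0_norm ?invr_ge0.
rewrite -nx -normrZ -linearZ/= -[leLHS]RRe_real ?normr_real// lecR.
apply: ub_le_sup; first by case: (opnorm_has_sup T).
exists (`|x|^-1 *: x) => //=.
by rewrite normrZ nx mulVf// normr_eq0.
Qed.

Lemma opnorm_le T (M : R) :
  (forall x, `|x| <= 1 -> `|T x| <= M%:C) -> opnorm T <= M.
Proof.
move=> TM; apply: ge_sup; first by case: (opnorm_has_sup T).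
by move=> _ [x /= x1 <-]; rewrite -lecR RRe_real ?normr_real// TM.
Qed.

Lemma opnorm_ge0 T : 0 <= opnorm T.
Proof.
apply: ub_le_sup; first by case: (opnorm_has_sup T).
by exists 0; rewrite /= ?linear0 normr0.
Qed.

Lemma opnormD S T : (opnorm (S + T))%:C <= (opnorm S)%:C + (opnorm T)%:C.
Proof.
rewrite -rmorphD lecR; apply: opnorm_le => x x1.
rewrite (le_trans (ler_normD _ _))// rmorphD lerD//.
- by rewrite (le_trans (opnorm_ub _ _))// ler_piMr// lecR opnorm_ge0.
- by rewrite (le_trans (opnorm_ub _ _))// ler_piMr// lecR opnorm_ge0.
Qed.

Lemma opnormZ (c : R[i]) T : (opnorm (c *: T))%:C = `|c| * (opnorm T)%:C.
Proof.
have le1 (d : R[i]) S : (opnorm (d *: S))%:C <= `|d| * (opnorm S)%:C.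
  have [r dE] : exists r : R, `|d| = r%:C by exists (Normc.normc d).
  rewrite dE -rmorphM lecR; apply: opnorm_le => x x1.
  rewrite normrZ dE rmorphM; apply: ler_pM => //; first by rewrite -dE.
  by rewrite (le_trans (opnorm_ub _ _))// ler_piMr// lecR opnorm_ge0.
apply/eqP; rewrite eq_le le1/=.
have [->|c0] := eqVneq c 0.
  by rewrite normr0 mul0r lecR opnorm_ge0.
rewrite -ler_pdivlMl ?normr_gt0// -normfV.
by rewrite -[T in leLHS](@scalerK _ _ c) ?unitfE// le1.
Qed.

Lemma opnorm0_eq0 T : (opnorm T)%:C = 0 :> R[i] -> T = 0.
Proof.
move=> T0; apply: bop_ext => x; apply/eqP; rewrite -normr_le0.
by rewrite (le_trans (opnorm_ub _ _))// T0 mul0r.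
Qed.

HB.instance Definition _ := @Lmodule_isNormed.Build R[i] bop
  (fun T => (opnorm T)%:C) opnormD opnormZ opnorm0_eq0.

Lemma bop_normE T : `|T| = (opnorm T)%:C. Proof. by []. Qed.

(* The adjoint exists by the Riesz representation theorem and is unique; the
   default value 0 is never used. *)
Definition adj T : bop :=
  xget 0 [set S : bop | forall x y, ip (T x) y = ip x (S y)].

End BoundedOperators.

Notation "''B' ( H )" := (bop H) (at level 8, format "''B' ( H )") : type_scope.
Notation "T ^†" := (adj T) (at level 1, left associativity, format "T ^†") : ring_scope.

Record unital_cstar_subalgebra (R : realType) (H : hilbertType R)
    (A : set 'B(H)) : Prop := {
  cstar_one : A 1 ;
  cstar_add : forall S T, A S -> A T -> A (S + T) ;
  cstar_scale : forall (c : R[i]) T, A T -> A (c *: T) ;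
  cstar_mul : forall S T, A S -> A T -> A (S * T) ;
  cstar_adj : forall T, A T -> A T^† ;
  cstar_closed : closed A
}.

Record star_automorphism (R : realType) (H : hilbertType R)
    (A : set 'B(H)) (f : 'B(H) -> 'B(H)) : Prop := {
  starauto_bij : set_bij A A f ;
  starauto_add : forall S T, A S -> A T -> f (S + T) = f S + f T ;
  starauto_scale : forall (c : R[i]) T, A T -> f (c *: T) = c *: f T ;
  starauto_mul : forall S T, A S -> A T -> f (S * T) = f S * f T ;
  starauto_adj : forall T, A T -> f T^† = (f T)^†
}.

Record unitary_representation (R : realType) (H : hilbertType R)
    (G : groupType) (U : G -> 'B(H)) : Prop := {
  urep_one : U 1%g = 1 ;
  urep_mul : forall g h, U (g * h)%g = U g * U h ;
  urep_adjl : forall g, (U g)^† * U g = 1 ;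
  urep_adjr : forall g, U g * (U g)^† = 1
}.

Definition conj_action (R : realType) (H : hilbertType R) (G : groupType)
  (U : G -> 'B(H)) (g : G) (a : 'B(H)) : 'B(H) := U g * a * (U g)^†.

Section CharacterSpace.
Variables (R : realType) (H : hilbertType R) (Z : set 'B(H)).

(* Functionals are defined on the elements of Z only; since the subtype Z
   carries no operations, the axioms refer to the underlying operators. *)
Definition is_character : set {ptws Z -> R[i]} :=
  [set chi : Z -> R[i] |
    [/\ exists z, chi z != 0,
        forall x y z : Z, \val z = \val x + \val y -> chi z = chi x + chi y,
        forall (c : R[i]) (x z : Z), \val z = c *: \val x -> chi z = c * chi x
      & forall x y z : Z, \val z = \val x * \val y -> chi z = chi x * chi y]].

(* The topology is the one induced by pointwise convergence on Z, i.e. the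
   weak-* topology. *)
Definition char_space := set_type is_character.
HB.instance Definition _ := Topological.on char_space.

Definition gelfand (z : Z) (m : char_space) : R[i] := (\val m : Z -> R[i]) z.

End CharacterSpace.

Definition supp (R : realType) (M : topologicalType) (f : M -> R[i]) : set M :=
  closure [set m | f m != 0].

Definition supnorm (R : realType) (M : Type) (f : M -> R[i]) : R :=
  sup [set complex.Re `|f m| | m in [set: M]].

(* On R[i], 0 <= x <= 1 entails that x is real. *)
Definition bumps (R : realType) (M : topologicalType) (Delta : set M) :
    set (M -> R[i]) :=
  [set f : M -> R[i] | [/\ continuous f, forall m, 0 <= f m <= 1, supnorm f = 1
             & supp f `<=` Delta]].

Definition homeomorphism (M N : topologicalType) (f : M -> N) : Prop :=
  continuous f /\
  exists g : N -> M, [/\ continuous g, cancel f g & cancel g f].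

(* Main.v *)
Require Import Defs.
From HB Require Import structures.
From mathcomp Require Import all_boot all_order all_algebra.
From mathcomp Require Import sesquilinear finmap complex.
From mathcomp Require Import all_classical all_reals all_analysis.
From mathcomp Require Import ring lra.
Set Implicit Arguments.
Unset Strict Implicit.
Unset Printing Implicit Defensive.
Import Order.TTheory GRing.Theory Num.Theory.
Import numFieldNormedType.Exports.
Local Open Scope classical_set_scope.
Local Open Scope ring_scope.
Local Open Scope complex_scope.

(** Write [X] for [b^* b] and [Y] for the operator on the smaller side.
    Expanding the product, [X] is the sum over [s, t] of
    [alpha_s^-1 (a_s^* a_t) U_(s^-1 t)], and [Y] keeps the terms with [s = t]
    or [s^-1 t] in [Dt].

    Let [w] in [Z] be a contraction whose Gelfand transform vanishes wherever
    that of [z] does, hence off [Delta].  Moving [w] through a term [c U_g]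
    turns it into [alpha_g w], so that [z c U_g w = c (z alpha_g w) U_g].  If
    [g] fixes [Delta] pointwise then [z alpha_g w = w z]; if [g] moves [Delta]
    off itself then [z alpha_g w = 0].  Hence [z X w = w z Y] and
    [|w z Y| <= |z X| |w| <= |z X|].  It remains to have [w z] close to [z]:
    [w = 1 - (1 - z)^n] satisfies [|w| <= 1] and
    [|z - w z| = |z (1 - z)^n| <= 1 / (n + 1)] ([rnorm_localizer],
    [rnorm_localizer_defect]), and [n] tends to infinity.

    All these facts about [Z] are read off on characters, by means of the
    part of Gelfand's theorem that says that the norm of [y] in [Z] is at most
    the supremum of [|chi y|] ([rnorm_le_gelfand]).  Characters are obtained
    as joint approximate eigenvalues.  A family of operators is [approx_null]
    when every finite part of it is nearly annihilated by some nonzero vector.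
    Given such a family and a self-adjoint [T] commuting with it, maximising
    [|T x|] over the vectors that the family nearly annihilates produces an
    approximate eigenvalue of [T * T] compatible with the family
    ([approx_null_extend]), and one of [T] itself after a translation
    ([approx_null_eigen_selfadj]).  So in a maximal family [Phi] inside [Z]
    every [T] of [Z] has a unique [c] with [T - c] in [Phi], and [T |-> c] is a
    character bounded by the norm ([approx_null_character]).  Beginning with
    the norm of [y^* y] gives a character at which [y] attains its norm
    ([norm_attained]).

    Adjoints are taken from the Riesz representation theorem
    ([riesz_real]). *)

(** * Real-valued norms and the real inner product *)

(** Norms of [R[i]]-normed modules take values in [R[i]], whose order is
    partial; all estimates are therefore carried out on their real parts. *)
Definition rnorm (R : realType) (V : normedZmodType R[i]) (x : V) : R :=
  complex.Re `|x|.

Section RealNorm.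
Variables (R : realType) (V : normedModType R[i]).
Implicit Types x y : V.

Lemma rnormE x : `|x| = (rnorm x)%:C.
Proof. by rewrite /rnorm RRe_real ?normr_real. Qed.

Lemma rnorm_ge0 x : 0 <= rnorm x.
Proof. by rewrite -lecR -rnormE normr_ge0. Qed.

Lemma rnormD x y : rnorm (x + y) <= rnorm x + rnorm y.
Proof. by rewrite -lecR rmorphD /= -!rnormE ler_normD. Qed.

Lemma rnormZ (c : R[i]) x : rnorm (c *: x) = rnorm c * rnorm x.
Proof.
apply: complexI; rewrite rmorphM /= -rnormE normrZ rnormE.
by rewrite /rnorm RRe_real ?normr_real.
Qed.

Lemma rnormN x : rnorm (- x) = rnorm x.
Proof. by rewrite /rnorm normrN. Qed.

Lemma rnormB x y : rnorm (x - y) <= rnorm x + rnorm y.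
Proof. by rewrite -(rnormN y) rnormD. Qed.

Lemma rnorm0 : rnorm (0 : V) = 0.
Proof. by rewrite /rnorm normr0. Qed.

Lemma rnorm_gt0 x : (0 < rnorm x) = (x != 0).
Proof. by rewrite -ltcR -rnormE normr_gt0. Qed.

Lemma le_rnorm x y : (`|x| <= `|y|) = (rnorm x <= rnorm y).
Proof. by rewrite !rnormE lecR. Qed.

End RealNorm.

Section ComplexNorm.
Variable R : realType.

Lemma rnorm_real (r : R) : rnorm (r%:C : R[i]) = `|r|.
Proof. by rewrite /rnorm normc_def /= expr0n addr0 sqrtr_sqr. Qed.

Lemma rnormM (c d : R[i]) : rnorm (c * d) = rnorm c * rnorm d.
Proof. exact: (rnormZ c (d : R[i])). Qed.

Lemma le_of_sqr (a b : R) : 0 <= b -> a ^+ 2 <= b ^+ 2 -> a <= b.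
Proof. by move=> b0 ab; rewrite leNgt; apply/negP => ba; nra. Qed.

End ComplexNorm.

Section InnerProduct.
Variables (R : realType) (H : hilbertType R).
Implicit Types x y : H.

(** Squares and minimisation take place in [R], so the Hilbert space is used
    through its underlying real inner product; the complex one is recovered
    from it by [ip_rip]. *)
Definition rip x y : R := complex.Re (ip x y).

Lemma ripDl x y u : rip (x + y) u = rip x u + rip y u.
Proof. by rewrite /rip linearDl /= raddfD. Qed.

Lemma ripC x y : rip x y = rip y x.
Proof. by rewrite /rip hermC /= expr0 mul1r; case: (ip y x). Qed.

Lemma ripDr x y u : rip u (x + y) = rip u x + rip u y.
Proof. by rewrite ripC ripDl !(ripC u). Qed.

Lemma ripZl (r : R) x y : rip (r%:C *: x) y = r * rip x y.
Proof.
rewrite /rip linearZl_LR /=; case: (ip x y) => a b /=.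
by rewrite mul0r subr0.
Qed.

Lemma ripZr (r : R) x y : rip x (r%:C *: y) = r * rip x y.
Proof. by rewrite ripC ripZl ripC. Qed.

Lemma ripNl x y : rip (- x) y = - rip x y.
Proof. by rewrite /rip linearNl /= raddfN. Qed.

Lemma ripNr x y : rip x (- y) = - rip x y.
Proof. by rewrite ripC ripNl ripC. Qed.

Lemma rip_norm x : rip x x = rnorm x ^+ 2.
Proof.
apply: complexI; rewrite rmorphXn /= -rnormE -ip_norm RRe_real//.
by rewrite ip_norm rpredX ?normr_real.
Qed.

Lemma ip_rip x y : ip x y = rip x y -i* rip ('i%C *: x) y.
Proof.
rewrite /rip linearZl_LR /=; case: (ip x y) => a b /=.
by rewrite mul0r mul1r add0r opprK.
Qed.

Lemma rnorm_sqrD x y :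
  rnorm (x + y) ^+ 2 = rnorm x ^+ 2 + 2 * rip x y + rnorm y ^+ 2.
Proof. by rewrite -!rip_norm ripDl !ripDr (ripC y x); ring. Qed.

Lemma rnorm_sqrB x y :
  rnorm (x - y) ^+ 2 = rnorm x ^+ 2 - 2 * rip x y + rnorm y ^+ 2.
Proof. by rewrite rnorm_sqrD rnormN ripNr; ring. Qed.

Lemma rip0r x : rip x 0 = 0.
Proof. by have := ripDr 0 0 x; rewrite addr0 => h; lra. Qed.

(** The Cauchy-Schwarz inequality, read off from [0 <= | |y| x - |x| y |^2]. *)
Lemma rip_le x y : rip x y <= rnorm x * rnorm y.
Proof.
have [->|y0] := eqVneq y 0.
  by rewrite rnorm0 mulr0 rip0r lexx.
have ny : 0 < rnorm y by rewrite rnorm_gt0.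
have := sqr_ge0 (rnorm ((rnorm y)%:C *: x - (rnorm x)%:C *: y)).
rewrite rnorm_sqrB ripZl ripZr !rnormZ !rnorm_real !ger0_norm ?rnorm_ge0//.
have [->|x0] := eqVneq x 0.
  by move=> _; rewrite rnorm0 mul0r ripC rip0r lexx.
have nx : 0 < rnorm x by rewrite rnorm_gt0.
have nxy := mulr_gt0 nx ny.
move=> h; rewrite -(ler_pM2l nxy); nra.
Qed.

End InnerProduct.

(** * The Riesz representation theorem *)

Section Riesz.
Variables (R : realType) (H : hilbertType R).
Implicit Types x y u v : H.

Lemma hilbert_complete (u : nat -> H) :
  (forall e : R, 0 < e ->
     exists N, forall i j, (N <= i)%N -> (N <= j)%N -> rnorm (u i - u j) <= e) ->
  exists v, forall e : R, 0 < e ->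
     exists N, forall n, (N <= n)%N -> rnorm (v - u n) <= e.
Proof.
move=> uC.
have : cvg (u @ \oo).
  apply/cauchy_cvgP/cauchy_ballP => e e0.
  have [r re] : exists r : R, e = r%:C.
    by exists (complex.Re e); rewrite RRe_real// gtr0_real.
  have r0 : 0 < r / 2 by rewrite divr_gt0// -ltcR -re.
  have [N uN] := uC _ r0.
  exists (u @` [set i | (N <= i)%N], u @` [set i | (N <= i)%N]) => /=.
    by split; exists N => // i /= Ni; exists i.
  move=> [_ _] [[i Ni <-] [j Nj <-]]; rewrite -ball_normE /ball_ /=.
  rewrite rnormE re ltcR (le_lt_trans (uN _ _ Ni Nj))//.
  by rewrite ltr_pdivrMr// ltr_pMr ?ltr1n// -ltcR -re.
move=> /cvg_ex[v uv]; exists v => e e0.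
have eC : 0 < e%:C by rewrite ltcR.
move/cvgrPdist_le: uv => /(_ _ eC)[N _ uN].
by exists N => n Nn; have := uN n Nn; rewrite /= rnormE lecR.
Qed.

(** The minimiser of the strictly convex functional [|x|^2 - 2 phi x]
    represents [phi]; the parallelogram law makes minimising sequences Cauchy. *)
Lemma riesz_real (phi : H -> R) (C : R) :
  (forall x y, phi (x + y) = phi x + phi y) ->
  (forall (t : R) x, phi (t%:C *: x) = t * phi x) ->
  (forall x, phi x <= C * rnorm x) ->
  exists v, forall x, phi x = rip x v.
Proof.
move=> phiD phiZ phiC.
pose J x := rnorm x ^+ 2 - 2 * phi x.
have Jlb x : - C ^+ 2 <= J x.
  rewrite /J; have := phiC x; have := sqr_ge0 (rnorm x - C).
  by nra.
have Jinf : has_inf (range J).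
  split; first by exists (J 0); exists 0.
  by exists (- C ^+ 2) => _ [x _ <-]; exact: Jlb.
pose m := inf (range J).
have Jm x : m <= J x.
  by apply: ge_inf; [case: Jinf | exists x].
pose eps n : R := n.+1%:R^-1.
have eps0 n : 0 < eps n by rewrite invr_gt0.
have /choice[u um] : forall n, exists x, J x <= m + eps n ^+ 2.
  move=> n; have e0 : 0 < eps n ^+ 2 :> R by rewrite exprn_gt0// invr_gt0.
  by have [_ [x _ <-] xm] := inf_adherent e0 Jinf; exists x; exact: ltW.
(* Parallelogram law, with [m <= J ((x + y) / 2)]. *)
have par x y : rnorm (x - y) ^+ 2 <= 2 * (J x - m) + 2 * (J y - m).
  have := Jm ((2^-1)%:C *: (x + y)).
  rewrite /J phiZ phiD rnormZ rnorm_real exprMn rnorm_sqrB rnorm_sqrD.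
  rewrite ger0_norm ?invr_ge0//.
  move=> h; lra.
have uC i j : rnorm (u i - u j) <= 2 * (eps i + eps j).
  have i0 := eps0 i.
  have j0 := eps0 j.
  apply: le_of_sqr; first by rewrite mulr_ge0// addr_ge0// ltW.
  apply: (le_trans (par _ _)).
  have := um i; have := um j.
  set a := eps i in i0 *; set b := eps j in j0 *.
  have := mulr_gt0 i0 j0; have := sqr_ge0 a; have := sqr_ge0 b.
  move=> ????; nra.
(* An almost minimiser is almost critical: test [J] on the line through
   [u n] with direction [x], at the minimum [t] of the resulting quadratic. *)
have grad n x : `|rip x (u n) - phi x| <= eps n * rnorm x.
  have n0 := eps0 n.
  have [->|x0] := eqVneq x 0.
    have := phiZ 0 0; rewrite scaler0 mul0r => ->.
    by rewrite rnorm0 mulr0 ripC rip0r subrr normr0.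
  have N0 : 0 < rnorm x by rewrite rnorm_gt0.
  pose psi := rip x (u n) - phi x; rewrite -/psi.
  pose t : R := - psi / rnorm x ^+ 2.
  have tE : t * rnorm x ^+ 2 = - psi by rewrite /t divfK// expf_neq0// gt_eqF.
  have := Jm (u n + t%:C *: x).
  rewrite /J phiD phiZ rnorm_sqrD ripZr rnormZ rnorm_real exprMn.
  rewrite real_normK ?num_real//.
  rewrite ripC => h; have := um n; rewrite /J => h2.
  have h3 : - eps n ^+ 2 <= t * psi.
    have t2 : t ^+ 2 * rnorm x ^+ 2 = - (t * psi).
      by rewrite expr2 -mulrA tE mulrN.
    rewrite t2 /psi in h *; lra.
  apply: le_of_sqr; first by rewrite mulr_ge0 ?rnorm_ge0// ltW.
  rewrite real_normK ?num_real// exprMn.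
  have N2 : 0 < rnorm x ^+ 2 by rewrite exprn_gt0.
  move: h3; rewrite -(ler_pM2r N2) mulrAC tE; lra.
have small (e : R) : 0 < e -> exists N, forall n, (N <= n)%N -> eps n <= e.
  move=> e0; have ec : \forall n \near \oo, `|0 - eps n| <= e.
    by move/cvgrPdist_le : (@cvg_harmonic R); apply.
  have [N _ Ne] := ec; exists N => n /Ne /=.
  by rewrite sub0r normrN ger0_norm// invr_ge0.
have [|v uv] := @hilbert_complete u.
  move=> e e0; have e4 : 0 < e / 4 by rewrite divr_gt0.
  have [N Ne] := small _ e4; exists N => i j /Ne hi /Ne hj.
  by apply: (le_trans (uC i j)); lra.
exists v => x.
have [->|x0] := eqVneq x 0.
  have := phiZ 0 0; rewrite scaler0 mul0r => ->.
  by rewrite ripC rip0r.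
have N0 : 0 < rnorm x by rewrite rnorm_gt0.
apply/esym/eqP; rewrite -subr_eq0 -normr_le0; apply/ler_addgt0Pl => e e0.
rewrite addr0.
have e2 : 0 < e / 2 / rnorm x by rewrite !divr_gt0.
have [N1 h1] := uv _ e2; have [N2 h2] := small _ e2.
pose n := maxn N1 N2.
have {}h1 := h1 n (leq_maxl _ _); have {}h2 := h2 n (leq_maxr _ _).
have -> : rip x v - phi x = rip x (v - u n) + (rip x (u n) - phi x).
  by rewrite ripDr ripNr; ring.
apply: (le_trans (ler_normD _ _)); rewrite [leRHS](splitr e) lerD//; last first.
  by apply: (le_trans (grad n x)); rewrite -ler_pdivlMr.
apply: (@le_trans _ _ (rnorm x * rnorm (v - u n))); last first.
  by rewrite mulrC -ler_pdivlMr.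
rewrite ler_norml rip_le andbT lerNl -ripNr -(rnormN (v - u n)).
exact: rip_le.
Qed.

End Riesz.

(** * Adjoints and operator norms *)

Section Operators.
Variables (R : realType) (H : hilbertType R).
Implicit Types (S T : 'B(H)) (x y : H).

Lemma bopM S T x : (S * T) x = S (T x). Proof. by []. Qed.
Lemma bopD S T x : (S + T) x = S x + T x. Proof. by []. Qed.
Lemma bopZ c T x : (c *: T) x = c *: T x. Proof. by []. Qed.
Lemma bopN T x : (- T) x = - T x. Proof. by []. Qed.
Lemma bop1 x : (1 : 'B(H)) x = x. Proof. by []. Qed.
Lemma bop0 x : (0 : 'B(H)) x = 0. Proof. by []. Qed.

Definition scalar_op (c : R[i]) : 'B(H) := c *: (1 : 'B(H)).

Lemma scalar_opE c x : (scalar_op c) x = c *: x. Proof. by []. Qed.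

Lemma bop_scalel c S T : (c *: S) * T = c *: (S * T).
Proof. exact: bop_ext. Qed.

Lemma rnorm_op T x : rnorm (T x) <= rnorm T * rnorm x.
Proof. by rewrite -lecR rmorphM /= -!rnormE; exact: opnorm_ub. Qed.

Lemma rnorm_op_le T (M : R) : (forall x, rnorm (T x) <= M * rnorm x) -> 0 <= M ->
  rnorm T <= M.
Proof.
move=> TM M0; apply: opnorm_le => x x1; rewrite rnormE lecR (le_trans (TM x))//.
by rewrite ler_piMr// -lecR -rnormE.
Qed.

Lemma rnorm_opM S T : rnorm (S * T) <= rnorm S * rnorm T.
Proof.
apply: rnorm_op_le; last by rewrite mulr_ge0// rnorm_ge0.
move=> x; rewrite bopM (le_trans (rnorm_op _ _))// -mulrA.
by rewrite ler_wpM2l ?rnorm_ge0 ?rnorm_op.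
Qed.

Lemma ip_inj x y : (forall u, ip u x = ip u y) -> x = y.
Proof.
move=> xy; apply/eqP; rewrite -subr_eq0; apply/negPn/negP.
rewrite -rnorm_gt0 => /(exprn_gt0 2); rewrite -rip_norm.
by rewrite /rip linearBr /= xy subrr ltxx.
Qed.

(** Each [y] yields [T^† y] as the vector representing [x |-> <T x, y>]. *)
Lemma adj_exists T : exists S : 'B(H), forall x y, ip (T x) y = ip x (S y).
Proof.
have /choice[f fE] y : exists v, forall x, ip (T x) y = ip x v.
  have [|t x|x|v vE] := @riesz_real _ _ (fun x => rip (T x) y) (rnorm T * rnorm y).
  - by move=> x z /=; rewrite linearD ripDl.
  - by rewrite linearZ ripZl.
  - rewrite (le_trans (rip_le _ _))// mulrAC.
    by rewrite ler_wpM2r ?rnorm_ge0 ?rnorm_op.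
  by exists v => x; rewrite !ip_rip -!vE linearZ.
have f_lin : linear f.
  move=> c y z; apply: ip_inj => u.
  by rewrite -fE !linearDr !linearZr_LR /= -!fE.
have f_bnd : exists M : R, forall x, `|f x| <= M%:C * `|x|.
  exists (rnorm T) => x; rewrite !rnormE -rmorphM lecR.
  have [->|f0] := eqVneq (f x) 0.
    by rewrite rnorm0 mulr_ge0// rnorm_ge0.
  rewrite -rnorm_gt0 in f0; rewrite -(ler_pM2r f0) -expr2 -rip_norm.
  rewrite {1}/rip -fE -/(rip _ _) (le_trans (rip_le _ _))// mulrAC.
  by rewrite ler_wpM2r ?rnorm_ge0 ?rnorm_op.
have fP : f \in @bounded_op _ H by rewrite inE.
by exists (Bop fP) => x y; rewrite fE.
Qed.

Lemma adjP T x y : ip (T x) y = ip x (T^† y).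
Proof.
rewrite /adj; case: xgetP => [S _ /= ->//|].
by have [S SE] := adj_exists T => /(_ S).
Qed.

Lemma adj_uniq T S : (forall x y, ip (T x) y = ip x (S y)) -> T^† = S.
Proof.
by move=> TS; apply: bop_ext => y; apply: ip_inj => u; rewrite -adjP TS.
Qed.

Lemma adjK T : T^†^† = T.
Proof.
by apply: adj_uniq => x y; rewrite hermC /= -adjP [in RHS]hermC /= expr0 !mul1r.
Qed.

Lemma adjD S T : (S + T)^† = S^† + T^†.
Proof. by apply: adj_uniq => x y; rewrite linearDl /= !adjP -linearDr. Qed.

Lemma adjZ c T : (c *: T)^† = Num.conj c *: T^†.
Proof.
apply: adj_uniq => x y; rewrite !bopZ linearZl_LR linearZr_LR /= adjP.
by rewrite conjCK.
Qed.

Lemma adj0 : (0 : 'B(H))^† = 0.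
Proof. by rewrite -(scale0r 0) adjZ conjC0 !scale0r. Qed.

Lemma adj1 : (1 : 'B(H))^† = 1.
Proof. exact: adj_uniq. Qed.

Lemma adjM S T : (S * T)^† = T^† * S^†.
Proof. by apply: adj_uniq => x y; rewrite !bopM !adjP. Qed.

Lemma adj_sum (I : Type) (r : seq I) (P : pred I) (F : I -> 'B(H)) :
  (\sum_(i <- r | P i) F i)^† = \sum_(i <- r | P i) (F i)^†.
Proof. by apply: (big_morph (@adj R H) adjD adj0). Qed.

(** The half of the C*-identity that the estimates use. *)
Lemma rnorm_adjM T : rnorm T ^+ 2 <= rnorm (T^† * T).
Proof.
have N0 := rnorm_ge0 (T^† * T).
apply: (@le_trans _ _ (Num.sqrt (rnorm (T^† * T)) ^+ 2)); last by rewrite sqr_sqrtr.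
rewrite ler_pXn2r ?nnegrE ?rnorm_ge0 ?sqrtr_ge0//.
apply: rnorm_op_le; rewrite ?sqrtr_ge0// => x.
apply: le_of_sqr; first by rewrite mulr_ge0 ?sqrtr_ge0 ?rnorm_ge0.
rewrite exprMn sqr_sqrtr// -rip_norm {1}/rip adjP -/(rip _ _).
rewrite (le_trans (rip_le _ _))// mulrC expr2 mulrA ler_wpM2r ?rnorm_ge0//.
exact: (rnorm_op (T^† * T)).
Qed.

Lemma rnorm_adj T : rnorm T^† = rnorm T.
Proof.
have le S : rnorm S <= rnorm S^†.
  have [->|S0] := eqVneq S 0; first by rewrite rnorm0 rnorm_ge0.
  have nS : 0 < rnorm S by rewrite rnorm_gt0.
  by rewrite -(ler_pM2r nS) -expr2 (le_trans (rnorm_adjM S))// rnorm_opM.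
by apply/eqP; rewrite eq_le le -{2}(adjK T) le.
Qed.

End Operators.

Arguments scalar_op {R H} c.

(** * Joint approximate eigenvectors *)

Section ApproximateEigenvectors.
Variables (R : realType) (H : hilbertType R).
Implicit Types (S T : 'B(H)) (x y : H) (F : seq 'B(H)) (Phi : set 'B(H)).

Definition nearly_null F (e : R) x :=
  x != 0 /\ forall S, S \in F -> rnorm (S x) <= e * rnorm x.

(** The operators of [Phi] have a common approximate kernel.  This property
    has finite character, hence is subject to Zorn's lemma; for families of
    the form [T - c] it says that the [c] are joint approximate eigenvalues. *)
Definition approx_null Phi := forall F, (forall S, S \in F -> Phi S) ->
  forall e : R, 0 < e -> exists x, nearly_null F e x.

Lemma nearly_null_sub F F' (e e' : R) x : {subset F' <= F} -> e <= e' ->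
  nearly_null F e x -> nearly_null F' e' x.
Proof.
move=> FF ee [x0 xF]; split=> // S /FF/xF h; apply: (le_trans h).
by rewrite ler_wpM2r// rnorm_ge0.
Qed.

(** If [a], [b], [d] stand for the norms of [x], [T x], [T (T x)], the
    left-hand side is the square of [|T (T x) - p^2 x|] for self-adjoint [T]:
    it is small as soon as [T] stretches [x] by nearly its maximal factor [p]. *)
Lemma peak_estimate (p g a b d : R) : 0 < p -> 0 < g -> g <= 1 -> g <= p / 2 ->
  0 < a -> (p - g) * a <= b -> b <= (p + g) * a -> 0 <= d -> d <= (p + g) * b ->
  d ^+ 2 - 2 * p ^+ 2 * b ^+ 2 + p ^+ 4 * a ^+ 2
    <= g * (8 * p ^+ 3 + 4 * p ^+ 2 + 4 * p + 1) * a ^+ 2.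
Proof.
move=> p0 g0 g1 gp a0 lb ub d0 db.
have b0 : 0 <= b by apply: le_trans lb; rewrite mulr_ge0; lra.
have d2 : d ^+ 2 <= ((p + g) * ((p + g) * a)) ^+ 2.
  rewrite ler_pXn2r ?nnegrE//; last first.
    by rewrite !mulr_ge0; lra.
  by rewrite (le_trans db)// ler_wpM2l//; lra.
have b2 : ((p - g) * a) ^+ 2 <= b ^+ 2.
  by rewrite ler_pXn2r ?nnegrE// mulr_ge0; lra.
have p2b2 : p ^+ 2 * ((p - g) * a) ^+ 2 <= p ^+ 2 * b ^+ 2.
  by rewrite ler_wpM2l// sqr_ge0.
have key : (p + g) ^+ 4 + p ^+ 4 - 2 * p ^+ 2 * (p - g) ^+ 2
    <= g * (8 * p ^+ 3 + 4 * p ^+ 2 + 4 * p + 1).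
  have g2 : g ^+ 2 <= g by rewrite expr2 ler_piMr// ltW.
  have g3 : g ^+ 3 <= g.
    by rewrite exprS ler_piMr// ?(ltW g0)// (le_trans g2).
  have g4 : g ^+ 4 <= g.
    by rewrite exprS ler_piMr// ?(ltW g0)// (le_trans g3).
  have h2 : p ^+ 2 * g ^+ 2 <= p ^+ 2 * g by rewrite ler_wpM2l ?sqr_ge0.
  have h3 : p * g ^+ 3 <= p * g by rewrite ler_wpM2l// ltW.
  have -> : (p + g) ^+ 4 + p ^+ 4 - 2 * p ^+ 2 * (p - g) ^+ 2 =
    8 * p ^+ 3 * g + 4 * (p ^+ 2 * g ^+ 2) + 4 * (p * g ^+ 3) + g ^+ 4 by ring.
  lra.
have a2 : 0 <= a ^+ 2 by exact: sqr_ge0.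
have := ler_wpM2r a2 key.
have e1 : ((p + g) * ((p + g) * a)) ^+ 2 = (p + g) ^+ 4 * a ^+ 2 by ring.
have e2 : p ^+ 2 * ((p - g) * a) ^+ 2 = p ^+ 2 * (p - g) ^+ 2 * a ^+ 2 by ring.
rewrite e1 in d2; rewrite e2 in p2b2.
move=> h; lra.
Qed.

(** Let [p] be the essential norm of [T] on the approximate kernel of [Phi]:
    the infimum of the constants [r] with [|T x| <= r |x|] for all [x] that
    some finite part of [Phi] nearly annihilates.  If [x] nearly attains this
    bound then, as [T] commutes with [Phi], [T x] is again nearly annihilated,
    so that [|T (T x)|] is at most about [p |T x|]; by [peak_estimate], [x] is
    an approximate eigenvector of [T * T] for the eigenvalue [p^2].  The
    bound [c] keeps [p] away from [0], which makes [T x] comparable to [x]. *)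
Lemma approx_null_extend Phi T (c : R) : approx_null Phi -> T^† = T ->
  (forall S, Phi S -> S * T = T * S) -> 0 < c ->
  (forall F (e r : R), (forall S, S \in F -> Phi S) -> 0 < e ->
     (forall x, nearly_null F e x -> rnorm (T x) <= r * rnorm x) -> c <= r) ->
  exists2 p : R, c <= p & approx_null (Phi `|` [set T * T - scalar_op (p ^+ 2)%:C]).
Proof.
move=> Phi0 Tsa TC c0 cT.
pose B := [set r : R | exists F e, [/\ forall S, S \in F -> Phi S, 0 < e &
   forall x, nearly_null F e x -> rnorm (T x) <= r * rnorm x]].
have Bc : lbound B c by move=> r [F [e [FP e0 Fr]]]; exact: cT FP e0 Fr.
have Binf : has_inf B.
  split; last by exists c.
  by exists (rnorm T), [::], 1; split=> // x _; exact: rnorm_op.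
pose p := inf B.
have cp : c <= p by apply: lb_le_inf => //; case: Binf.
have p0 : 0 < p := lt_le_trans c0 cp.
exists p => // F FP e e0.
pose C := 8 * p ^+ 3 + 4 * p ^+ 2 + 4 * p + 1.
have C0 : 0 < C.
  by have := exprn_gt0 3 p0; have := exprn_gt0 2 p0; rewrite /C => ??; lra.
pose g := Num.min 1 (Num.min (p / 2) (e ^+ 2 / C)).
have g0 : 0 < g by rewrite !lt_min ltr01 !divr_gt0// exprn_gt0.
have g1 : g <= 1 by rewrite ge_min lexx.
have gp : g <= p / 2 by rewrite !ge_min lexx orbT.
have ge : g * C <= e ^+ 2 by rewrite -ler_pdivlMr// !ge_min lexx !orbT.
have [r [F1 [e1 [F1P e10 F1r]]] rp] := inf_adherent g0 Binf.
rewrite -/p in rp.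
pose F0 := [seq S <- F | S != T * T - scalar_op (p ^+ 2)%:C].
have F0P S : S \in F0 -> Phi S.
  by rewrite mem_filter => /andP[/eqP ST /FP[//|/= /ST]].
pose t := rnorm T + 1.
have t0 : 0 < t by rewrite ltr_wpDl ?rnorm_ge0.
(* The last bound gives [|S (T x)| <= |T| e2 |x| <= e1 (p / 2) |x| <= e1 |T x|]. *)
pose e2 := Num.min e (Num.min e1 (e1 * (p / 2) / t)).
have e20 : 0 < e2 by rewrite !lt_min e0 e10 !(mulr_gt0, divr_gt0, invr_gt0).
have F2P S : S \in F0 ++ F1 -> Phi S by rewrite mem_cat => /orP[/F0P|/F1P].
have [x xF xT] : exists2 x, nearly_null (F0 ++ F1) e2 x &
    (p - g) * rnorm x < rnorm (T x).
  apply: contrapT => h; have : B (p - g).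
    exists (F0 ++ F1), e2; split=> // x xF; rewrite leNgt; apply/negP => xT.
    by apply: h; exists x.
  by move/(ge_inf Binf.2); rewrite -/p; lra.
have [x0 xF2] := xF.
have nx : 0 < rnorm x by rewrite rnorm_gt0.
have Tx : p / 2 * rnorm x <= rnorm (T x).
  by apply: le_trans (ltW xT); rewrite ler_wpM2r ?rnorm_ge0//; lra.
have nTx : 0 < rnorm (T x) by apply: lt_le_trans Tx; rewrite mulr_gt0// divr_gt0.
have h1 : rnorm (T x) <= (p + g) * rnorm x.
  apply: (@le_trans _ _ (r * rnorm x)); last by rewrite ler_wpM2r ?rnorm_ge0// ltW.
  apply: F1r; apply: nearly_null_sub xF; last by rewrite !ge_min lexx !orbT.
  by move=> S SF; rewrite mem_cat SF orbT.
have h2 : rnorm (T (T x)) <= (p + g) * rnorm (T x).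
  apply: (@le_trans _ _ (r * rnorm (T x))); last by rewrite ler_wpM2r ?rnorm_ge0// ltW.
  apply: F1r; split; first by rewrite -rnorm_gt0.
  move=> S SF; have -> : S (T x) = T (S x) by rewrite -!bopM TC//; exact: F1P.
  apply: (le_trans (rnorm_op _ _)).
  have Sx : rnorm (S x) <= e2 * rnorm x by apply: xF2; rewrite mem_cat SF orbT.
  apply: (@le_trans _ _ (t * (e2 * rnorm x))).
    by apply: ler_pM => //; rewrite ?rnorm_ge0// /t lerDl.
  have e2t : t * e2 <= e1 * (p / 2).
    by rewrite mulrC -ler_pdivlMr// !ge_min lexx !orbT.
  rewrite mulrA; apply: (@le_trans _ _ (e1 * (p / 2) * rnorm x)).
    by rewrite ler_wpM2r ?rnorm_ge0.
  by rewrite -mulrA ler_wpM2l// ltW.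
exists x; split=> // S SF.
have [->|ST] := eqVneq S (T * T - scalar_op (p ^+ 2)%:C); last first.
  apply: (@le_trans _ _ (e2 * rnorm x)); last first.
    by rewrite ler_wpM2r ?rnorm_ge0// ge_min lexx.
  by apply: xF2; rewrite mem_cat mem_filter ST SF.
apply: le_of_sqr; first by rewrite mulr_ge0 ?rnorm_ge0// ltW.
have -> : (T * T - scalar_op (p ^+ 2)%:C) x = T (T x) - (p ^+ 2)%:C *: x.
  by rewrite bopD bopN bopM scalar_opE.
rewrite rnorm_sqrB ripZr rnormZ rnorm_real ger0_norm ?sqr_ge0//.
have -> : rip (T (T x)) x = rnorm (T x) ^+ 2.
  by rewrite /rip adjP Tsa -/(rip _ _) rip_norm.
have := peak_estimate p0 g0 g1 gp nx (ltW xT) h1 (rnorm_ge0 _) h2.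
rewrite -/C => hp; have := ler_wpM2r (sqr_ge0 (rnorm x)) ge.
have -> : (p ^+ 2 * rnorm x) ^+ 2 = p ^+ 4 * rnorm x ^+ 2 by ring.
by rewrite exprMn => hge; lra.
Qed.

End ApproximateEigenvectors.

(** * Maximal families with a common approximate kernel *)

Section MaximalApproxNull.
Variables (R : realType) (H : hilbertType R) (Z : set 'B(H)).
Hypothesis Z_cstar : unital_cstar_subalgebra Z.
Hypothesis Z_comm : forall S T, Z S -> Z T -> S * T = T * S.
Implicit Types (S T : 'B(H)) (F : seq 'B(H)) (Phi : set 'B(H)).

(** A maximal family plays the role of a maximal ideal of [Z]. *)
Definition maximal_approx_null Phi := [/\ Phi `<=` Z, approx_null Phi &
  forall T, Z T -> approx_null (Phi `|` [set T]) -> Phi T].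

Lemma exists_maximal_approx_null Phi0 : Phi0 `<=` Z -> approx_null Phi0 ->
  exists2 Phi, Phi0 `<=` Phi & maximal_approx_null Phi.
Proof.
move=> Phi0Z Phi0c.
pose P := [set Phi | Phi `<=` Z /\ approx_null (Phi `|` Phi0)].
(* [Phi0] is kept outside of [P], which then also contains the union of
   the empty chain. *)
have [|A [[AZ Ac] Amax]] := @Zorn_bigcup _ P.
  move=> C CP Ctot; split; first by move=> S [X /CP[XZ _]] /XZ.
  move=> F FC e e0.
  have [FP|[X [CX FX]]] : (forall S, S \in F -> Phi0 S) \/
      exists X, C X /\ forall S, S \in F -> (X `|` Phi0) S.
  + elim: F FC => [|S F IH] FC; first by left.
    have [S'|FP|[X [CX FX]]] := IH; first by move=> SF; apply: FC; rewrite inE SF orbT.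
    * have [[X CX XS]|S0] := FC S (mem_head _ _); last first.
        by left=> S'; rewrite inE => /predU1P[->//|/FP].
      right; exists X; split=> // S'; rewrite inE => /predU1P[->|/FP]; [by left|by right].
    * right; have [[Y CY YS]|S0] := FC S (mem_head _ _); last first.
        by exists X; split=> // S'; rewrite inE => /predU1P[->|/FX//]; right.
      have [XY|YX] := Ctot X Y CX CY.
        exists Y; split=> // S'; rewrite inE => /predU1P[->|/FX[/XY|]]; by [left|right].
      exists X; split=> // S'; rewrite inE => /predU1P[->|/FX//]; left; exact: YX.
  + exact: Phi0c FP e e0.
  + by have [_ Xc] := CP _ CX; exact: Xc FX e e0.
exists (A `|` Phi0); first by move=> S; right.
split=> //; first by move=> S [/AZ|/Phi0Z].
move=> T ZT Tc; left; apply: contrapT => AT.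
apply: (Amax (A `|` [set T])).
  split; first by move=> S; left.
  by move=> h; apply: AT; apply: h; right.
split; first by move=> S [/AZ//|->].
by move: Tc; rewrite -!setUA (setUC Phi0).
Qed.

Variable Phi : set 'B(H).
Hypothesis Phi_max : maximal_approx_null Phi.

(** The single form in which maximality is used; it contains the closure of
    [Phi] under sums and under multiplication by [Z]. *)
Lemma approx_null_dominated T S1 S2 (C : R) : Z T -> Phi S1 -> Phi S2 -> 0 <= C ->
  (forall x, rnorm (T x) <= C * (rnorm (S1 x) + rnorm (S2 x))) -> Phi T.
Proof.
have [PZ Pc Pm] := Phi_max.
move=> ZT P1 P2 C0 TS; apply: Pm => // F FP e e0.
pose e' := Num.min e (e / (2 * C + 1)).
have d0 : 0 < 2 * C + 1 by lra.
have e'0 : 0 < e' by rewrite lt_min e0 divr_gt0.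
have [|x [x0 xF]] := Pc [:: S1, S2 & [seq S <- F | S != T]] _ e' e'0.
  move=> S; rewrite !inE => /or3P[/eqP->//|/eqP->//|].
  by rewrite mem_filter => /andP[/eqP ST /FP[//|/= /ST]].
exists x; split=> // S SF.
have nx : 0 <= rnorm x := rnorm_ge0 x.
have [->|ST] := eqVneq S T; last first.
  apply: (@le_trans _ _ (e' * rnorm x)); last by rewrite ler_wpM2r// ge_min lexx.
  by apply: xF; rewrite !inE mem_filter ST SF !orbT.
apply: (le_trans (TS x)).
have h1 : rnorm (S1 x) <= e' * rnorm x by apply: xF; rewrite mem_head.
have h2 : rnorm (S2 x) <= e' * rnorm x by apply: xF; rewrite !inE eqxx orbT.
have h3 : e' * (2 * C + 1) <= e.
  by rewrite -ler_pdivlMr// ge_min lexx orbT.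
apply: (@le_trans _ _ (C * (e' * rnorm x + e' * rnorm x))).
  by rewrite ler_wpM2l// lerD.
have := ler_wpM2r nx h3; have : 0 <= e' * rnorm x by rewrite mulr_ge0// ltW.
by move=> h4 h5; lra.
Qed.

Lemma approx_null_eigen_uniq T c d : Phi (T - scalar_op c) -> Phi (T - scalar_op d) ->
  c = d.
Proof.
have [_ Pc _] := Phi_max.
move=> Tc Td; apply/eqP; rewrite -subr_eq0; apply/negPn/negP => cd.
have n0 : 0 < rnorm (c - d) / 3 by rewrite divr_gt0// rnorm_gt0.
have [|x [x0 xF]] := Pc [:: T - scalar_op c; T - scalar_op d] _ _ n0.
  by move=> S; rewrite !inE => /orP[/eqP->|/eqP->].
have nx : 0 < rnorm x by rewrite rnorm_gt0.
have h1 := xF _ (mem_head _ _).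
have h2 : rnorm ((T - scalar_op d) x) <= rnorm (c - d) / 3 * rnorm x.
  by apply: xF; rewrite !inE eqxx orbT.
have h3 : (c - d) *: x = (T - scalar_op d) x - (T - scalar_op c) x.
  rewrite !bopD !bopN !scalar_opE scalerBl opprB addrCA -addrA.
  by congr (_ + _); rewrite [T x + _]addrC subrK.
have := rnormB ((T - scalar_op d) x) ((T - scalar_op c) x).
rewrite -h3 rnormZ => h4; have := mulr_gt0 n0 nx; nra.
Qed.

Lemma approx_null_eigen_bound T c : Phi (T - scalar_op c) -> rnorm c <= rnorm T.
Proof.
have [_ Pc _] := Phi_max.
move=> Tc; apply/ler_addgt0Pr => e e0.
have [|x [x0 xF]] := Pc [:: T - scalar_op c] _ _ e0.
  by move=> S; rewrite mem_seq1 => /eqP->.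
have nx : 0 < rnorm x by rewrite rnorm_gt0.
have h1 := xF _ (mem_head _ _).
have h3 : c *: x = T x - (T - scalar_op c) x.
  by rewrite bopD bopN scalar_opE opprB addrC subrK.
have := rnormB (T x) ((T - scalar_op c) x); have := rnorm_op T x.
by rewrite -h3 rnormZ => h4 h5; rewrite -(ler_pM2r nx) mulrDl; lra.
Qed.

Lemma Z_scalar c : Z (scalar_op c).
Proof. by apply: (cstar_scale Z_cstar); exact: (cstar_one Z_cstar). Qed.

Lemma cstar_sub S T : Z S -> Z T -> Z (S - T).
Proof.
move=> ZS ZT; apply: (cstar_add Z_cstar) => //; rewrite -scaleN1r.
exact: (cstar_scale Z_cstar).
Qed.

Lemma comm_sqr (P Q : 'B(H)) : P * Q = Q * P -> Q * Q - P * P = (Q + P) * (Q - P).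
Proof. by move=> PQ; rewrite mulrDl !mulrBr PQ addrA subrK. Qed.

(** Translating [T] by [c = |T| + 1] bounds [T' + s] below for [s >= 0]: for
    [s = 0] this provides the hypothesis of [approx_null_extend], and for [s = p]
    it allows to cancel one factor of [T'^2 - p^2 = (T' + p) (T' - p)]. *)
Lemma approx_null_eigen_selfadj T : Z T -> T^† = T ->
  exists r : R, Phi (T - scalar_op r%:C).
Proof.
have [PZ Pc Pm] := Phi_max.
move=> ZT Tsa; pose c := rnorm T + 1; pose T' := T + scalar_op c%:C.
have ZT' : Z T' by apply: (cstar_add Z_cstar) => //; exact: Z_scalar.
have big (s : R) x : 0 <= s -> rnorm x <= rnorm ((T' + scalar_op s%:C) x).
  move=> s0; have := rnormB ((T' + scalar_op s%:C) x) (T x).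
  have -> : (T' + scalar_op s%:C) x - T x = (c + s)%:C *: x.
    rewrite /T' !bopD !scalar_opE addrC !addrA addNr add0r.
    by rewrite (rmorphD _ c s) scalerDl.
  have nx := rnorm_ge0 x; have nT := rnorm_ge0 T.
  rewrite rnormZ rnorm_real ger0_norm /c; last lra.
  have := rnorm_op T x => h1 h2; have := mulr_ge0 s0 nx; lra.
have [|S PS|||p p1 pc] := @approx_null_extend _ _ Phi T' 1 Pc.
- rewrite adjD adjZ adj1 Tsa; congr (_ + _ *: _).
  by rewrite conj_Creal// complex_real.
- by apply: Z_comm => //; exact: PZ.
- exact: ltr01.
- move=> F e r FP e0 h; have [x [x0 xF]] := Pc F FP e e0.
  have nx : 0 < rnorm x by rewrite rnorm_gt0.
  rewrite -(ler_pM2r nx) mul1r (le_trans _ (h x _))//.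
  have := big 0 x (lexx _).
  by rewrite bopD scalar_opE scale0r addr0.
have PT := Pm _ _ pc.
exists (p - c).
have {}PT : Phi (T' * T' - scalar_op (p ^+ 2)%:C).
  by apply: PT; apply: cstar_sub; [exact: (cstar_mul Z_cstar)|exact: Z_scalar].
have -> : T - scalar_op (p - c)%:C = T' - scalar_op p%:C.
  apply: bop_ext => x; rewrite /T' !bopD !bopN !scalar_opE rmorphB scalerBl.
  by rewrite opprB addrA.
apply: (approx_null_dominated _ PT PT ler01).
  by apply: cstar_sub => //; exact: Z_scalar.
move=> x; rewrite mul1r.
apply: (@le_trans _ _ (rnorm ((T' * T' - scalar_op (p ^+ 2)%:C) x))); last first.
  by rewrite lerDl rnorm_ge0.
have -> : T' * T' - scalar_op (p ^+ 2)%:C =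
    (T' + scalar_op p%:C) * (T' - scalar_op p%:C).
  rewrite -comm_sqr; last exact: Z_comm (Z_scalar _) ZT'.
  by rewrite /scalar_op bop_scalel mul1r scalerA -rmorphM expr2.
by apply: big; lra.
Qed.

(** The Cartesian decomposition [T = re_part T + i im_part T] into
    self-adjoint operators; [- 2^-1 * 'i] is [1 / (2 i)]. *)
Definition re_part T : 'B(H) := 2^-1 *: (T + T^†).
Definition im_part T : 'B(H) := (- 2^-1 * 'i) *: (T - T^†).

Lemma re_imE T : re_part T + 'i *: im_part T = T.
Proof.
rewrite /re_part /im_part scalerA mulrCA -expr2 sqrCi mulrNN mulr1 -scalerDr.
rewrite addrACA subrr addr0 -mulr2n -scalerMnr scalerMnl.
by rewrite -[_ *+ 2]mulr_natr mulVf ?pnatr_eq0// scale1r.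
Qed.

Lemma approx_null_eigen T : Z T -> exists c, Phi (T - scalar_op c).
Proof.
move=> ZT; have ZTa := cstar_adj Z_cstar ZT.
have Zr : Z (re_part T).
  by apply: (cstar_scale Z_cstar); exact: (cstar_add Z_cstar).
have Zi : Z (im_part T) by apply: (cstar_scale Z_cstar); exact: cstar_sub.
have adjN S : (- S)^† = - S^†.
  by rewrite -scaleN1r adjZ rmorphN rmorph1 scaleN1r.
have [|r Pr] := approx_null_eigen_selfadj Zr.
  rewrite /re_part adjZ adjD adjK addrC; congr (_ *: _).
  by rewrite conj_Creal// rpredV realn.
have [|s Ps] := approx_null_eigen_selfadj Zi.
  rewrite /im_part adjZ adjD adjN adjK -[T^† - T]opprB scalerN -scaleNr.
  congr (_ *: _); rewrite rmorphM rmorphN /= conjCi.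
  rewrite (@conj_Creal _ 2^-1) ?rpredV ?realn//; ring.
exists (r%:C + 'i * s%:C).
apply: (approx_null_dominated _ Pr Ps ler01).
  by apply: cstar_sub => //; exact: Z_scalar.
move=> x; rewrite mul1r.
have -> : (T - scalar_op (r%:C + 'i * s%:C)) x =
    (re_part T - scalar_op r%:C) x + 'i *: (im_part T - scalar_op s%:C) x.
  rewrite -{1}(re_imE T) !bopD !bopN !scalar_opE bopZ scalerBr scalerDl opprD.
  by rewrite addrACA (scalerA 'i s%:C x).
rewrite (le_trans (rnormD _ _))// rnormZ.
by rewrite {2}/rnorm normCi mul1r.
Qed.

End MaximalApproxNull.

(** * Characters and the norm *)

Section Characters.
Variables (R : realType) (H : hilbertType R) (Z : set 'B(H)).
Hypothesis Z_cstar : unital_cstar_subalgebra Z.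
Hypothesis Z_comm : forall S T, Z S -> Z T -> S * T = T * S.

Lemma val_in_Z (z : Z) : Z (\val z).
Proof. exact: set_valP. Qed.

Definition to_Z T (ZT : Z T) : Z := SigSub (mem_set ZT).

(** The eigenvalues are multiplicative because
    [x y - c d = x (y - d) + d (x - c)]. *)
Lemma approx_null_character Phi : maximal_approx_null Z Phi ->
  exists m : char_space Z, forall z : Z, Phi (\val z - scalar_op (gelfand z m)).
Proof.
move=> Pmax; have [PZ Pc Pm] := Pmax.
have /choice[chi chiP] (z : Z) : exists c, Phi (\val z - scalar_op c).
  by apply: (approx_null_eigen Z_cstar Z_comm Pmax); exact: val_in_Z.
have ZZ (z : Z) c : Z (\val z - scalar_op c).
  by apply: (cstar_sub Z_cstar); [exact: val_in_Z | exact: Z_scalar].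
have Zs c : Z (scalar_op c) by exact: Z_scalar.
suff chi_char : is_character chi.
  by exists (SigSub (mem_set chi_char)) => z; exact: chiP.
split.
- exists (to_Z (cstar_one Z_cstar)).
  have := chiP (to_Z (cstar_one Z_cstar)); set c := chi _ => h.
  apply/eqP => c0; move: h; rewrite c0 {c c0} => h.
  have l0 : 0 < 1 / 2 :> R by lra.
  have [|x [x0 xF]] := Pc [:: (1 - scalar_op 0 : 'B(H))] _ _ l0.
    by move=> S; rewrite mem_seq1 => /eqP->.
  have nx : 0 < rnorm x by rewrite rnorm_gt0.
  have := xF _ (mem_head _ _).
  rewrite bopD bopN bop1 scalar_opE scale0r subr0; lra.
- move=> x y z zE; apply: (approx_null_eigen_uniq Pmax (chiP z)).
  apply: (approx_null_dominated Pmax _ (chiP x) (chiP y) ler01) => [|u].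
    exact: ZZ.
  rewrite mul1r (le_trans _ (rnormD _ _))// zE.
  by rewrite !bopD !bopN !scalar_opE scalerDl opprD addrACA.
- move=> c x z zE; apply: (approx_null_eigen_uniq Pmax (chiP z)).
  apply: (approx_null_dominated Pmax _ (chiP x) (chiP x) (rnorm_ge0 c)) => [|u].
    exact: ZZ.
  rewrite mulrDr (_ : (\val z - scalar_op (c * chi x)) u =
      c *: (\val x - scalar_op (chi x)) u).
    by rewrite rnormZ lerDl mulr_ge0 ?rnorm_ge0.
  by rewrite zE !bopD !bopN !scalar_opE bopZ scalerBr scalerA.
- move=> x y z zE; apply: (approx_null_eigen_uniq Pmax (chiP z)).
  pose C := rnorm (\val x) + rnorm (chi y).
  have C0 : 0 <= C by rewrite addr_ge0// rnorm_ge0.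
  apply: (approx_null_dominated Pmax _ (chiP x) (chiP y) C0) => [|u].
    exact: ZZ.
  rewrite (_ : (\val z - scalar_op (chi x * chi y)) u =
     \val x ((\val y - scalar_op (chi y)) u) +
     chi y *: (\val x - scalar_op (chi x)) u); last first.
    rewrite zE !bopD !bopN !scalar_opE bopM (linearB (\val x)) (linearZZ (\val x)).
    by rewrite scalerBr scalerA addrA subrK mulrC.
  rewrite (le_trans (rnormD _ _))// rnormZ.
  have h1 := rnorm_op (\val x) ((\val y - scalar_op (chi y)) u).
  have n1 := rnorm_ge0 (\val x); have n2 := rnorm_ge0 (chi y).
  have n3 := rnorm_ge0 ((\val y - scalar_op (chi y)) u).
  have n4 := rnorm_ge0 ((\val x - scalar_op (chi x)) u).
  rewrite /C; have := mulr_ge0 n1 n4; have := mulr_ge0 n2 n3; lra.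
Qed.

(** Start the maximal family from [h^2 - p^2], where [h = y^* y]; with the
    empty family in [approx_null_extend], [p] is at least the norm of [h].  Then
    [|y|^2 <= |h| <= p = |chi (y^* y)| <= |y| |chi y|]. *)
Lemma norm_attained (y : Z) : \val y != 0 ->
  exists m : char_space Z, rnorm (\val y) <= rnorm (gelfand y m).
Proof.
move=> y0; pose T := \val y.
have ZT : Z T := val_in_Z y.
have ZTa := cstar_adj Z_cstar ZT.
pose h := T^† * T.
have Zh : Z h by exact: (cstar_mul Z_cstar).
have nT : 0 < rnorm T by rewrite rnorm_gt0.
have nh : 0 < rnorm h by apply: lt_le_trans (rnorm_adjM T); rewrite exprn_gt0.
have c0 : approx_null (set0 : set 'B(H)).
  move=> F F0 e e0; have [x x0] : exists x : H, x != 0.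
    apply: contrapT => /forallNP H0; move: y0; rewrite -/T => /eqP; apply.
    apply: bop_ext => x; have /negP := H0 (T x); rewrite negbK => /eqP ->.
    by rewrite bop0.
  by exists x; split=> // S /F0.
have [||F e r F0 e0 hr|p hp pc] := approx_null_extend (T := h) c0 _ _ nh.
- by rewrite adjM adjK.
- by [].
- have r0 : 0 <= r.
    have [x x0] := c0 F F0 e e0; have := hr _ x0.
    have := rnorm_ge0 (h x); have : 0 < rnorm x by rewrite rnorm_gt0; case: x0.
    by move=> a b c; rewrite -(pmulr_lge0 _ a); lra.
  apply: rnorm_op_le => // x.
  have [->|x0] := eqVneq x 0; first by rewrite linear0 rnorm0 mulr0.
  by apply: hr; split=> // S /F0.
have pZ : set0 `|` [set h * h - scalar_op (p ^+ 2)%:C] `<=` Z.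
  move=> S [//|->]; apply: (cstar_sub Z_cstar); first exact: (cstar_mul Z_cstar).
  exact: Z_scalar.
have [Phi PhiP Pmax] := exists_maximal_approx_null pZ pc.
have [m mP] := approx_null_character Pmax.
exists m.
have [_ _ _ mM] : is_character (\val m) by exact: set_valP.
pose ya := to_Z ZTa; pose hz := to_Z Zh.
pose hh := to_Z (cstar_mul Z_cstar Zh Zh).
have hhE : gelfand hh m = (p ^+ 2)%:C.
  by apply: (approx_null_eigen_uniq Pmax (mP hh)); apply: PhiP; right.
have E1 : gelfand hh m = gelfand hz m * gelfand hz m by exact: mM.
have E2 : gelfand hz m = gelfand ya m * gelfand y m by exact: mM.
have pE : p = rnorm (gelfand ya m) * rnorm (gelfand y m).
  rewrite -rnormM -E2; apply/eqP; rewrite -(@eqrXn2 _ 2) ?rnorm_ge0//; last lra.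
  by rewrite [in X in _ == X]expr2 -rnormM -E1 hhE rnorm_real ger0_norm ?sqr_ge0.
have b1 : rnorm (gelfand ya m) <= rnorm T.
  by rewrite -(rnorm_adj T); exact: (approx_null_eigen_bound Pmax (mP ya)).
rewrite -/T -(ler_pM2l nT) -expr2 (le_trans (rnorm_adjM T))// (le_trans hp)//.
by rewrite pE ler_wpM2r ?rnorm_ge0.
Qed.

Lemma rnorm_le_gelfand (y : Z) (r : R) : 0 <= r ->
  (forall m : char_space Z, rnorm (gelfand y m) <= r) -> rnorm (\val y) <= r.
Proof.
move=> r0 yr; have [->|y0] := eqVneq (\val y) 0; first by rewrite rnorm0.
by have [m /le_trans] := norm_attained y0; apply.
Qed.

End Characters.

(** * Contractions localised on the support of an element *)

Section Evaluation.
Variables (R : realType) (H : hilbertType R) (Z : set 'B(H)).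
Hypothesis Z_cstar : unital_cstar_subalgebra Z.
Hypothesis Z_comm : forall S T, Z S -> Z T -> S * T = T * S.
Implicit Types (S T : 'B(H)) (m : char_space Z).

(** Characters are functions on the subtype [Z]; their extension by [0] to all
    operators frees algebraic computations from membership proofs. *)
Definition ev m T : R[i] :=
  if pselect (Z T) is left ZT then gelfand (to_Z ZT) m else 0.

Lemma ev_val m (y : Z) : ev m (\val y) = gelfand y m.
Proof.
rewrite /ev; case: pselect => [ZT|]; last by move=> h; have := h (val_in_Z y).
by congr gelfand; exact: val_inj.
Qed.

Lemma evE m T (ZT : Z T) : ev m T = gelfand (to_Z ZT) m.
Proof. by rewrite -ev_val. Qed.

Lemma evD m S T : Z S -> Z T -> ev m (S + T) = ev m S + ev m T.
Proof.
move=> ZS ZT; have [_ mD _ _] : is_character (\val m) by exact: set_valP.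
by rewrite (evE m ZS) (evE m ZT) (evE m (cstar_add Z_cstar ZS ZT)); exact: mD.
Qed.

Lemma evZ m c T : Z T -> ev m (c *: T) = c * ev m T.
Proof.
move=> ZT; have [_ _ mZ _] : is_character (\val m) by exact: set_valP.
by rewrite (evE m ZT) (evE m (cstar_scale Z_cstar c ZT)); exact: mZ.
Qed.

Lemma evM m S T : Z S -> Z T -> ev m (S * T) = ev m S * ev m T.
Proof.
move=> ZS ZT; have [_ _ _ mM] : is_character (\val m) by exact: set_valP.
by rewrite (evE m ZS) (evE m ZT) (evE m (cstar_mul Z_cstar ZS ZT)); exact: mM.
Qed.

Lemma evB m S T : Z S -> Z T -> ev m (S - T) = ev m S - ev m T.
Proof.
move=> ZS ZT; rewrite -scaleN1r evD ?evZ ?mulN1r//.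
exact: (cstar_scale Z_cstar).
Qed.

Lemma ev0 m : ev m 0 = 0.
Proof. by rewrite -(subrr 1) evB ?subrr//; exact: (cstar_one Z_cstar). Qed.

Lemma ev1 m : ev m 1 = 1.
Proof.
have Z1 := cstar_one Z_cstar.
have [[y my0] _ _ _] : is_character (\val m) by exact: set_valP.
have y0 : ev m (\val y) != 0 by rewrite ev_val.
by apply: (mulfI y0); rewrite -evM ?mulr1//; exact: val_in_Z.
Qed.

Lemma Z_exp T n : Z T -> Z (T ^+ n).
Proof.
move=> ZT; elim: n => [|n IH]; first by rewrite expr0; exact: (cstar_one Z_cstar).
by rewrite exprS; exact: (cstar_mul Z_cstar).
Qed.

Lemma evX m T n : Z T -> ev m (T ^+ n) = ev m T ^+ n.
Proof.
move=> ZT; elim: n => [|n IH]; first by rewrite !expr0 ev1.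
by rewrite !exprS evM ?IH//; exact: Z_exp.
Qed.

Lemma rnorm_le_ev T (r : R) : Z T -> 0 <= r ->
  (forall m, rnorm (ev m T) <= r) -> rnorm T <= r.
Proof.
move=> ZT r0 Tr; apply: (rnorm_le_gelfand Z_cstar Z_comm (y := to_Z ZT) r0) => m.
by rewrite -evE.
Qed.

(** Characters separate the points of [Z], hence identities in [Z] may be
    checked on the character space. *)
Lemma ev_inj S T : Z S -> Z T -> (forall m, ev m S = ev m T) -> S = T.
Proof.
move=> ZS ZT ST; apply/eqP; rewrite -subr_eq0; apply/negPn/negP.
rewrite -rnorm_gt0 ltNge => /negP; apply; apply: rnorm_le_ev => //.
  exact: (cstar_sub Z_cstar).
by move=> m; rewrite evB// ST subrr rnorm0.
Qed.

End Evaluation.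

(** Each of the [n + 1] terms of
    [1 - (1 - t)^(n + 1) = t (1 + (1 - t) + ... + (1 - t)^n)] is at least the
    last one. *)
Lemma exp_peak (R : realFieldType) (t : R) n : 0 <= t -> t <= 1 ->
  n.+1%:R * (t * (1 - t) ^+ n) <= 1 - (1 - t) ^+ n.+1.
Proof.
move=> t0 t1; have s0 : 0 <= 1 - t by lra.
elim: n => [|n IH]; first by rewrite expr0 expr1; lra.
have sn : 0 <= (1 - t) ^+ n := exprn_ge0 n s0.
have h : (1 - t) ^+ n.+1 <= (1 - t) ^+ n by rewrite exprS ler_piMl//; lra.
have k := ler_wpM2l t0 h.
have n0 : 0 <= n.+1%:R :> R by [].
have k2 := ler_wpM2l n0 k.
rewrite -[n.+2%:R]natr1 [(1 - t) ^+ n.+2]exprS; lra.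
Qed.

Section Localizer.
Variables (R : realType) (H : hilbertType R) (Z : set 'B(H)).
Hypothesis Z_cstar : unital_cstar_subalgebra Z.
Hypothesis Z_comm : forall S T, Z S -> Z T -> S * T = T * S.
Variable z : 'B(H).
Hypothesis Zz : Z z.
Hypothesis z01 : forall m : char_space Z, 0 <= ev m z <= 1.

(** A substitute for an Urysohn function that equals [1] on the support of [z]:
    a contraction that vanishes wherever [z] does, with [localizer n * z]
    converging to [z] in norm.  Being a polynomial in [z], it lies in [Z]. *)
Definition localizer n : 'B(H) := 1 - (1 - z) ^+ n.

Lemma Z_1subz : Z (1 - z).
Proof. by apply: (cstar_sub Z_cstar) => //; exact: (cstar_one Z_cstar). Qed.

Lemma Z_localizer n : Z (localizer n).
Proof.
apply: (cstar_sub Z_cstar); first exact: (cstar_one Z_cstar).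
exact: (Z_exp Z_cstar _ Z_1subz).
Qed.

Lemma ev_localizer (m : char_space Z) n : ev m (localizer n) = 1 - (1 - ev m z) ^+ n.
Proof.
have Z1 := cstar_one Z_cstar; have Z1z := Z_1subz.
by rewrite evB// ?ev1 ?evX ?evB ?ev1//; exact: Z_exp.
Qed.

Lemma ev_unit_interval (m : char_space Z) :
  exists2 t : R, 0 <= t <= 1 & ev m z = t%:C.
Proof.
have /andP[z0 z1] := z01 m.
have tE : (complex.Re (ev m z))%:C = ev m z by rewrite RRe_real// ger0_real.
by exists (complex.Re (ev m z)) => //; rewrite -ler0c -lecR tE z0.
Qed.

Lemma rnorm_localizer n : rnorm (localizer n) <= 1.
Proof.
apply: (rnorm_le_ev Z_cstar Z_comm (Z_localizer n) ler01) => m.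
rewrite ev_localizer; have [t /andP[t0 t1] ->] := ev_unit_interval m.
have s0 : 0 <= 1 - t by lra.
have sn : 0 <= (1 - t) ^+ n := exprn_ge0 n s0.
have sn1 : (1 - t) ^+ n <= 1 by rewrite exprn_ile1//; lra.
rewrite -(rmorph1 (real_complex R)) -rmorphB -rmorphXn -rmorphB /= rnorm_real.
by rewrite ger0_norm; lra.
Qed.

Lemma rnorm_localizer_defect n : rnorm ((1 - z) ^+ n * z) <= n.+1%:R^-1.
Proof.
have Z1 := cstar_one Z_cstar; have Z1z := Z_1subz.
have Zn := Z_exp Z_cstar n Z1z.
apply: (rnorm_le_ev Z_cstar Z_comm) => // [|m]; first exact: (cstar_mul Z_cstar).
rewrite evM// evX// evB// ev1//; have [t /andP[t0 t1] ->] := ev_unit_interval m.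
have s0 : 0 <= 1 - t by lra.
have sn : 0 <= (1 - t) ^+ n := exprn_ge0 n s0.
rewrite -(rmorph1 (real_complex R)) -rmorphB -rmorphXn -rmorphM /= rnorm_real.
rewrite ger0_norm; last by rewrite mulr_ge0.
rewrite -div1r ler_pdivlMr// mulrC [_ * t]mulrC (le_trans (exp_peak n t0 t1))//.
by rewrite gerBl exprn_ge0.
Qed.

End Localizer.

(** * Covariance and localisation of the crossed terms *)

Section CrossedTerms.
Variables (R : realType) (H : hilbertType R) (A Z : set 'B(H)).
Variables (G : groupType) (U : G -> 'B(H)).
Hypothesis U_rep : unitary_representation U.

Lemma urepV g : U g^-1%g = (U g)^†.
Proof.
by rewrite -[LHS]mulr1 -(urep_adjr U_rep g) mulrA -(urep_mul U_rep) mulVg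
  (urep_one U_rep) mul1r.
Qed.

Lemma conj_action_intertwines g T : U g * T = conj_action U g T * U g.
Proof. by rewrite /conj_action -mulrA (urep_adjl U_rep) mulr1. Qed.

Lemma pinv_conj_action s T : star_automorphism A (conj_action U s) -> A T ->
  let S := 'pinv_(fun=> 0) A (conj_action U s) T in
  A S /\ S = (U s)^† * T * U s.
Proof.
move=> [aA _ _ _ _] AT S; have [_ _ aS] := aA.
have [Sfun _ _] := bijpinv_bij (fun=> 0) aA.
split; first exact: Sfun.
have <- : conj_action U s S = T by apply: (surjpK (fun=> 0) aS); exact: mem_set.
rewrite /conj_action !mulrA (urep_adjl U_rep) mul1r -mulrA (urep_adjl U_rep).
by rewrite mulr1.
Qed.

Hypothesis Z_cstar : unital_cstar_subalgebra Z.
Hypothesis Z_sub : Z `<=` A.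
Hypothesis Z_central : forall z a : 'B(H), Z z -> A a -> z * a = a * z.
Hypothesis alpha_Z : forall g : G, star_automorphism Z (conj_action U g).
Variable beta : G -> char_space Z -> char_space Z.
Hypothesis beta_alpha : forall (g : G) (z w : Z) (m : char_space Z),
      \val w = conj_action U g (\val z) ->
      gelfand z (beta g m) = gelfand w m.

Lemma Z_comm S T : Z S -> Z T -> S * T = T * S.
Proof. by move=> ZS /Z_sub; exact: Z_central. Qed.

Lemma Z_conj_action g T : Z T -> Z (conj_action U g T).
Proof. by have [[ZZ _ _] _ _ _ _] := alpha_Z g; exact: ZZ. Qed.

Lemma ev_conj_action g m T : Z T -> ev m (conj_action U g T) = ev (beta g m) T.
Proof.
move=> ZT; rewrite (evE m (Z_conj_action g ZT)) (evE _ ZT); apply/esym.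
exact: beta_alpha.
Qed.

Lemma mul_crossed_term g (c z w : 'B(H)) : A c -> Z z -> Z w ->
  z * (c * U g) * w = c * (z * conj_action U g w) * U g.
Proof.
move=> Ac Zz Zw; rewrite mulrA (Z_central Zz Ac) -!mulrA.
by rewrite conj_action_intertwines !mulrA.
Qed.

(** On [Delta] the functions [localizer z n] and its translate agree, and
    outside of [Delta] both sides vanish. *)
Lemma conj_action_localizer g (z : 'B(H)) n (Delta : set (char_space Z)) :
  Z z -> (forall m, ev m z != 0 -> Delta m) ->
  (forall m, Delta m -> beta g m = m) ->
  z * conj_action U g (localizer z n) = localizer z n * z.
Proof.
move=> Zz zD gD; have Zw := Z_localizer Z_cstar Zz n.
have Zgw := Z_conj_action g Zw.
apply: (ev_inj Z_cstar Z_comm); [exact: (cstar_mul Z_cstar)..|move=> m].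
rewrite (evM Z_cstar m Zz Zgw) (evM Z_cstar m Zw Zz) ev_conj_action// mulrC.
have [->|/zD/gD->//] := eqVneq (ev m z) 0.
by rewrite !mulr0.
Qed.

(** Where [z] is nonzero, the point [m] lies in [Delta], its image under
    [beta g] does not, and the localizer vanishes there. *)
Lemma conj_action_localizer_disjoint g (z : 'B(H)) n (Delta : set (char_space Z)) :
  Z z -> (forall m, ev m z != 0 -> Delta m) ->
  beta g @` Delta `&` Delta = set0 ->
  z * conj_action U g (localizer z n) = 0.
Proof.
move=> Zz zD gD; have Zw := Z_localizer Z_cstar Zz n.
have Zgw := Z_conj_action g Zw.
have Z0 : Z 0 by rewrite -(subrr z); exact: (cstar_sub Z_cstar).
apply: (ev_inj Z_cstar Z_comm) => //; [exact: (cstar_mul Z_cstar)|move=> m].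
rewrite (evM Z_cstar m Zz Zgw) ev_conj_action// (ev0 Z_cstar).
have [->|/zD Dm] := eqVneq (ev m z) 0; first by rewrite mul0r.
rewrite (ev_localizer Z_cstar)//.
have [->|/zD Dbm] := eqVneq (ev (beta g m) z) 0.
  by rewrite subr0 expr1n subrr mulr0.
have : (beta g @` Delta `&` Delta) (beta g m) by split=> //; exists m.
by rewrite gD.
Qed.

End CrossedTerms.

Lemma bump_supported (R : realType) (M : topologicalType) (Delta : set M)
  (f : M -> R[i]) m : bumps Delta f -> f m != 0 -> Delta m.
Proof. by case=> _ _ _ fD fm; apply: fD; exact: subset_closure. Qed.

Lemma sum_split_diag (V : nmodType) (G : groupType) (r : seq G) (s : G)
    (P : pred G) (F : G -> V) : s \in r -> uniq r ->
  \sum_(t <- r) (if (s == t) || P t then F t else 0) =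
  F s + \sum_(t <- r | (s != t) && P t) F t.
Proof.
move=> sr ur; rewrite (bigD1_seq s)//= eqxx /=; congr (_ + _).
rewrite big_mkcondr; under eq_bigl => t do rewrite eq_sym.
by apply: eq_bigr => t /negPf->.
Qed.

(** * The norm estimate *)

Local Close Scope complex_scope.

Theorem proposition4 (R : realType) (H : hilbertType R) (A Z : set 'B(H))
    (G : groupType) (U : G -> 'B(H))
    (beta : G -> char_space Z -> char_space Z)
    (A_cstar : unital_cstar_subalgebra A)
    (Z_cstar : unital_cstar_subalgebra Z)
    (Z_sub : Z `<=` A)
    (Z_central : forall z a : 'B(H), Z z -> A a -> z * a = a * z)
    (U_rep : unitary_representation U)
    (alpha_A : forall g : G, star_automorphism A (conj_action U g))
    (alpha_Z : forall g : G, star_automorphism Z (conj_action U g))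
    (beta_homeo : forall g : G, homeomorphism (beta g))
    (beta_alpha : forall (g : G) (z w : Z) (m : char_space Z),
      \val w = conj_action U g (\val z) ->
      gelfand z (beta g m) = gelfand w m)
    (G0 : {fset G})
    (V : set (char_space Z)) (V_open : open V) (V_neq0 : V !=set0)
    (D0 Dt : {fset G})
    (G0'E : [fset (s^-1 * t)%g | s in G0, t in G0]%fset = (D0 `|` Dt)%fset)
    (D0E : D0 = ([fset (s^-1 * t)%g | s in G0, t in G0] `\` Dt)%fset)
    (Delta : set (char_space Z)) (Delta_neq0 : Delta !=set0)
    (Delta_sub : Delta `<=` V) (Delta_open : open Delta)
    (beta_Dt : forall g : G, g \in Dt -> forall m, Delta m -> beta g m = m)
    (beta_D0 : forall g : G, g \in D0 -> beta g @` Delta `&` Delta = set0)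
    (a : G -> 'B(H)) (a_A : forall g : G, g \in G0 -> A (a g))
    (z : Z) (z_Delta : bumps Delta (gelfand z)) :
  let alpha_inv (s : G) := 'pinv_(fun=> 0) A (conj_action U s) in
  let b := \sum_(g <- G0) a g * U g in
  let a_tilde := \sum_(s <- G0) alpha_inv s ((a s)^† * a s) in
  `| \val z * b^† * b | >=
  `| \val z *
     (a_tilde +
      \sum_(s <- G0) \sum_(t <- G0 | (s != t) && ((s^-1 * t)%g \in Dt))
        alpha_inv s ((a s)^† * a t) * U (s^-1 * t)%g) |.
Proof.
cbv zeta; set alpha_inv := fun s : G => 'pinv_(fun=> 0) A (conj_action U s).
set b := \sum_(g <- G0) a g * U g.
set a_tilde := \sum_(s <- G0) alpha_inv s ((a s)^† * a s).
have zZ : Z (\val z) := val_in_Z z.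
have Zc : forall S T, Z S -> Z T -> S * T = T * S := Z_comm Z_sub Z_central.
have zD m : ev m (\val z) != 0 -> Delta m.
  by rewrite ev_val; exact: bump_supported z_Delta.
have z01 (m : char_space Z) : 0 <= ev m (\val z) <= 1.
  by rewrite ev_val; case: z_Delta => _ + _ _; apply.
set Y := (X in `|\val z * X|).
pose X := b^† * b; rewrite -mulrA -/X.
pose c s t := alpha_inv s ((a s)^† * a t).
have cE s t : s \in G0 -> t \in G0 ->
    A (c s t) /\ c s t = (U s)^† * ((a s)^† * a t) * U s.
  move=> sG tG; apply: pinv_conj_action => //.
  apply: (cstar_mul A_cstar); last exact: a_A.
  by apply: (cstar_adj A_cstar); exact: a_A.
have XE : X = \sum_(s <- G0) \sum_(t <- G0) c s t * U (s^-1 * t)%g.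
  rewrite /X /b adj_sum mulr_suml; apply: eq_big_seq => s sG.
  rewrite mulr_sumr; apply: eq_big_seq => t tG.
  rewrite (cE s t sG tG).2 adjM (urep_mul U_rep) (urepV U_rep) !mulrA.
  by rewrite -[_ * U s * (U s)^†]mulrA (urep_adjr U_rep) mulr1.
have YE : Y = \sum_(s <- G0) \sum_(t <- G0)
    (if (s == t) || ((s^-1 * t)%g \in Dt) then c s t * U (s^-1 * t)%g else 0).
  rewrite /Y /a_tilde -big_split /=; apply: eq_big_seq => s sG.
  rewrite (sum_split_diag (fun t => (s^-1 * t)%g \in Dt)) ?fset_uniq//.
  by rewrite mulVg (urep_one U_rep) mulr1.
pose w := localizer (\val z).
have Zw n : Z (w n) by exact: (Z_localizer Z_cstar).
(* Localisation kills exactly the terms with [s^-1 t] outside of [Dt]. *)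
have zXw n : \val z * X * w n = w n * \val z * Y.
  rewrite XE YE !mulr_sumr mulr_suml; apply: eq_big_seq => s sG.
  rewrite !mulr_sumr mulr_suml; apply: eq_big_seq => t tG.
  have [Ac _] := cE s t sG tG.
  rewrite (mul_crossed_term U_rep Z_central)//.
  case: ifPn => [st|].
    have -> : \val z * conj_action U (s^-1 * t)%g (w n) = w n * \val z.
      case/orP: st => [/eqP <-|stD].
        rewrite mulVg /conj_action (urep_one U_rep) adj1 mul1r mulr1.
        exact: Zc.
      exact: (conj_action_localizer Z_cstar Z_sub Z_central alpha_Z
        beta_alpha n zZ zD (beta_Dt _ stD)).
    rewrite -(Z_central _ _ _ Ac) ?mulrA//; exact: (cstar_mul Z_cstar).
  rewrite negb_or => /andP[_ stD].
  rewrite (conj_action_localizer_disjoint Z_cstar Z_sub Z_central alpha_Z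
    beta_alpha n zZ zD).
    by rewrite !(mulr0, mul0r).
  apply: beta_D0; rewrite D0E inE stD andTb; apply/imfset2P.
  by exists s => //; exists t.
rewrite le_rnorm; apply/ler_addgt0Pr => e e0.
pose n := Num.trunc (rnorm Y / e).
have Yn : n.+1%:R^-1 * rnorm Y <= e.
  rewrite mulrC ler_pdivrMr// -ler_pdivrMl// mulrC ltW//; exact: truncnS_gt.
have -> : \val z * Y = \val z * X * w n + (1 - \val z) ^+ n * \val z * Y.
  by rewrite zXw -mulrDl -mulrDl /w /localizer subrK mul1r.
apply: (le_trans (rnormD _ _)); apply: lerD.
  apply: (le_trans (rnorm_opM _ _)).
  by rewrite ler_piMr ?rnorm_ge0// (rnorm_localizer Z_cstar Zc).
apply: (le_trans (rnorm_opM _ _)); apply: le_trans Yn.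
by rewrite ler_wpM2r ?rnorm_ge0// (rnorm_localizer_defect Z_cstar Zc).
Qed.
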